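(* Let $n \geq 1$ be an integer and let $F_n(x) = 1 + x + \frac{x^2}{2} + \cdots + \frac{x^n}{n} \in \mathbf{Q}[x]$. If $n \equiv 0, 2, 3 \pmod{4}$, or if $n \equiv 1 \pmod 4$ and $n = p^e$ for some prime $p$ and some odd positive integer $e$, then the discriminant $\operatorname{disc}(F_n)$ is not the square of a rational number.
   Context: The discriminant of a polynomial $P$ of degree $n$ with leading coefficient $a_n$ is $\operatorname{disc} P = (-1)^{\binom{n}{2}} a_n^{-1}\operatorname{Res}(P,P')$. $\mathbf{Q}^{\times 2}$ denotes the set of squares of nonzero rationals. *)

(* Defs.v *)
From HB Require Import structures.
From mathcomp Require Import all_boot all_order all_algebra.

Set Implicit Arguments.
Unset Strict Implicit.
Unset Printing Implicit Defensive.

Import GRing.Theory.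
Local Open Scope ring_scope.

(* [resultant] uses the Sylvester matrix with coefficients in increasing degree
   order, which changes the usual Res(p, q) by (-1) ^ (deg p * deg q).  This sign
   is 1 for q = p^`(), since deg p * (deg p - 1) is even. *)
Definition disc (p : {poly rat}) : rat :=
  (-1) ^+ 'C((size p).-1, 2) * (lead_coef p)^-1 * resultant p p^`().

Definition Fpoly (n : nat) : {poly rat} :=
  1 + \sum_(1 <= k < n.+1) (k%:R)^-1 *: 'X^k.

(* Main.v *)
Require Import Defs.
From mathcomp Require Import all_boot all_order all_algebra.
From mathcomp Require Import all_field zify.

(** The derivative of F_n is Phi = 1 + x + ... + x^(n-1), so up to sign
    disc F_n = n Res(F_n, Phi).  If p is a prime with p^k <= n < 2 p^k and
    k > 0, then x^(p^k) / p^k is the only term of F_n whose coefficient has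
    p-adic valuation <= -k; hence p^k F_n is a unit times x^(p^k) modulo p,
    which is coprime to Phi, and disc F_n has valuation v_p(n) - k (n - 1).
    - For even n > 2, Bertrand's postulate gives such a p with k = 1 and p not
      dividing n: the valuation is odd.
    - For n = p^e with n and e odd, k = e: the valuation is odd.
    - For n = 3 mod 4, p = 2 shows that the discriminant is nonzero, and it is
      nonpositive because Res(F_n, Phi) is the product of F_n(z) over the n-th
      roots of unity z <> 1, which come in conjugate pairs. *)

(** * Bertrand's postulate *)

(* Erdős' proof: if there is no prime in (m, 2m], then the prime factors of
   'C(2m, m) are at most 2m / 3, and those above the square root of 2m occur
   with exponent at most 1, so that 'C(2m, m) is too small. *)

Lemma prod_pfactor_widen (n m : nat) : 0 < n -> n <= m ->
  n = \prod_(0 <= p < m.+1) p ^ logn p n.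
Proof.
by move=> n0 nm; rewrite -{1}(partnT n0) (widen_partn _ nm).
Qed.

(** Each selected prime occurs in the factorization of [M] with exponent at least 1, so the product
    is bounded factor by factor. *)
Lemma leq_prod_primes (a b M : nat) (P : pred nat) : 0 < M ->
  (forall p, a <= p < b -> P p -> prime p && (p %| M)) ->
  \prod_(a <= p < b | P p) p <= M.
Proof.
move=> M0 PM; set B := maxn M b.
rewrite [leqRHS](prod_pfactor_widen M B) ?leq_maxl //.
rewrite (big_nat_widenl a 0) // (big_nat_widen 0 b B.+1) ?leqW ?leq_maxr //.
rewrite big_mkcond; apply: leq_prod => p _.
case: ifP => [/andP[/andP[Pp ap] pb]|_]; last exact: pfactor_gt0.
have /andP[pp pM] : prime p && (p %| M) by apply: PM; rewrite ?ap ?pb.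
by rewrite -{1}(expn1 p) leq_exp2l ?prime_gt1 // -pfactor_dvdn // expn1.
Qed.

(** The equal coefficients of index [k] and [k.+1] both occur in the expansion of (1 + 1)^(2k+1) = 2
    * 4^k. *)
Lemma bin_odd_central_le (k : nat) : 'C(k.*2.+1, k) <= 4 ^ k.
Proof.
rewrite -(leq_pmul2l (isT : 0 < 2)).
have -> : 2 * 4 ^ k = 2 ^ k.*2.+1 by rewrite expnS -mul2n expnM.
rewrite -[2 in X in _ <= X]/(1 + 1) expnDn.
have kk : k < k.*2.+2 by lia.
rewrite (bigD1 (Ordinal kk)) //=.
have kk1 : k.+1 < k.*2.+2 by lia.
rewrite (bigD1 (Ordinal kk1)) /=; last by rewrite -val_eqE /=; lia.
rewrite !exp1n !muln1 -(@bin_sub k.*2.+1 k.+1); last by lia.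
rewrite (_ : k.*2.+1 - k.+1 = k); last by lia.
by rewrite mul2n -addnn addnA leq_addr.
Qed.

Lemma prime_dvd_bin_gt (p n k : nat) : prime p -> k < p -> n - k < p -> p <= n ->
  p %| 'C(n, k).
Proof.
move=> pp kp nkp pn; have kn : k <= n by lia.
have: p %| n`! by rewrite dvdn_fact // prime_gt0.
rewrite -(bin_fact kn) !Euclid_dvdM // => /orP[//|].
have fact_ndvd j : j < p -> ~~ (p %| j`!).
  move=> jp; rewrite -prime_coprime // coprime_sym.
  elim: j jp => [|j IH] jp; first by rewrite coprime1n.
  rewrite factS coprimeMl IH 1?ltnW // andbT coprime_sym prime_coprime //.
  by rewrite gtnNdvd.
by rewrite (negPf (fact_ndvd _ kp)) (negPf (fact_ndvd _ nkp)).
Qed.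

(** Strong induction. An even n > 2 adds no prime. For n = 2k+1, the primes up to k+1 contribute at
    most 4^(k+1) by induction, and those above k+1 all divide 'C(2k+1, k) <= 4^k. *)
Lemma primorial_le (n : nat) : \prod_(0 <= p < n.+1 | prime p) p <= 4 ^ n.
Proof.
elim/ltn_ind: n => n IH.
have [n2|n2] := leqP n 2.
  by case: n n2 {IH} => [|[|[|]]] // _; rewrite unlock.
have [on|en] := boolP (odd n); last first.
  case: n n2 en IH => // n n2 en IH.
  rewrite big_mkcond big_nat_recr //= -big_mkcond /=.
  have -> : prime n.+1 = false.
    apply/negP => /even_prime; rewrite (negPf en) => -[n1|//].
    by rewrite n1 in n2.
  by rewrite muln1 (leq_trans (IH n _)) // leq_pexp2l.
have [k def_n] : exists k, n = k.*2.+1 by exists n./2; lia.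
have lekn : k.+2 <= n.+1 by lia.
rewrite (big_cat_nat (n := k.+2)) //=.
have -> : 4 ^ n = 4 ^ k.+1 * 4 ^ k by rewrite -expnD def_n; congr (_ ^ _); lia.
apply: leq_mul; first by apply: IH; lia.
apply: leq_trans (bin_odd_central_le k).
apply: leq_prod_primes => [|p /andP[kp pn] pp]; first by rewrite bin_gt0; lia.
by rewrite pp prime_dvd_bin_gt //; lia.
Qed.

(** * Prime powers in central binomial coefficients *)

(** By Legendre's formula each k contributes floor(2m / p^k) - 2 floor(m / p^k) <= 1 to the
    exponent, and nothing once p^k > 2m. *)
Lemma pfactor_bin_central_le (p m : nat) : prime p -> 0 < m ->
  p ^ logn p 'C(m.*2, m) <= m.*2.
Proof.
move=> pp m0; have m20 : 0 < m.*2 by lia.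
have mm : m <= m.*2 by lia.
apply: leq_trans (trunc_logP (prime_gt1 pp) m20).
rewrite leq_exp2l ?prime_gt1 //.
have logE : logn p m`! + logn p m`! + logn p 'C(m.*2, m) = logn p (m.*2)`!.
  rewrite -(bin_fact mm) (_ : m.*2 - m = m); last by lia.
  by rewrite !lognM ?muln_gt0 ?fact_gt0 ?bin_gt0 // addnC.
set T := trunc_log p m.*2.
have big k : m < k -> m %/ p ^ k = 0.
  by move=> mk; rewrite divn_small // (ltn_trans mk) // ltn_expl // prime_gt1.
have log_m : logn p m`! = \sum_(1 <= k < m.*2.+1) m %/ p ^ k.
  rewrite logn_fact // (big_cat_nat (n := m.+1) (p := m.*2.+1)) //=.
  rewrite [X in _ + X]big_nat_cond [X in _ + X]big1 ?addn0 //.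
  by move=> k /andP[/andP[mk _] _]; apply: big.
(* Writing [T] as a sum over the same range makes the comparison termwise. *)
have cntT : \sum_(1 <= k < m.*2.+1) (k <= T : nat) = T.
  have Tm : T < m.*2.+1.
    by rewrite ltnS ltnW // (leq_trans (ltn_expl _ (prime_gt1 pp))) // trunc_logP // prime_gt1.
  rewrite (big_cat_nat (n := T.+1)) //=.
  rewrite [X in _ + X]big_nat_cond [X in _ + X]big1 ?addn0; last first.
    by move=> k /andP[/andP[mk _] _]; rewrite leqNgt mk.
  rewrite big_nat_cond (eq_bigr (fun=> 1)); last first.
    by move=> k /andP[/andP[_ kT] _]; rewrite -ltnS kT.
  by rewrite -big_nat_cond sum_nat_const_nat muln1 subSS subn0.
rewrite -(leq_add2l (logn p m`! + logn p m`!)) logE logn_fact // log_m -cntT -!big_split /=.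
apply: leq_sum => k _.
have pk0 : 0 < p ^ k by rewrite expn_gt0 prime_gt0.
have [kT|Tk] := leqP k T.
  rewrite -ltnS ltn_divLR //; have := ltn_ceil m pk0.
  set q := m %/ p ^ k; set x := p ^ k; nia.
rewrite divn_small // (leq_trans (trunc_log_ltn _ (prime_gt1 pp))) //.
by rewrite leq_exp2l // prime_gt1.
Qed.

Lemma logn_fact_lt_square (p n : nat) : prime p -> n < p ^ 2 -> logn p n`! = n %/ p.
Proof.
move=> pp np; rewrite logn_fact //.
case: n np => [|n] np; first by rewrite big_geq // div0n.
rewrite big_ltn // expn1 big_nat_cond big1 ?addn0 // => k /andP[/andP[k2 _] _].
by rewrite divn_small // (leq_trans np) // leq_exp2l // prime_gt1.
Qed.

Lemma logn_bin_central_lt_square (p m : nat) : prime p -> m.*2 < p ^ 2 ->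
  logn p 'C(m.*2, m) = m.*2 %/ p - (m %/ p).*2.
Proof.
move=> pp mp; have mm : m <= m.*2 by lia.
have : logn p m`! + logn p m`! + logn p 'C(m.*2, m) = logn p (m.*2)`!.
  rewrite -(bin_fact mm) (_ : m.*2 - m = m); last by lia.
  by rewrite !lognM ?muln_gt0 ?fact_gt0 ?bin_gt0 // addnC.
by rewrite !logn_fact_lt_square //; lia.
Qed.

(** Passing from m+1 to m+2 multiplies the right side by 2(2m+3)/(m+1) >= 4. *)
Lemma expn4_le_bin_central (m : nat) : 0 < m -> 4 ^ m <= m.*2 * 'C(m.*2, m).
Proof.
elim: m => // -[_ _|m IH _] //.
have /(_ isT) {}IH := IH.
have step : m.+2 * 'C(m.+2.*2, m.+2) = (m.+1.*2.+1).*2 * 'C(m.+1.*2, m.+1).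
  have e1 : m.+2 * 'C(m.+2.*2, m.+2) = m.+2.*2 * 'C(m.+1.*2.+1, m.+1).
    by rewrite -mul_bin_diag.
  have e2 : m.+2 * 'C(m.+1.*2.+1, m.+1) = m.+1.*2.+1 * 'C(m.+1.*2, m.+1).
    have := mul_bin_down m.+1.*2.+1 m.+1.
    by rewrite (_ : m.+1.*2.+1 - m.+1 = m.+2) //; lia.
  rewrite e1 -[m.+2.*2]muln2 -mulnA mulnCA e2; lia.
rewrite -doubleMl step expnS.
move: IH; set c := 'C(_, _); set x := 4 ^ _ => IH.
have : 4 * x <= 4 * (m.+1.*2 * c) by rewrite leq_pmul2l.
nia.
Qed.

Lemma bin_central_le_of_no_prime (m r : nat) : 2 < m -> r ^ 2 <= m.*2 < r.+1 ^ 2 ->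
    (forall p, prime p -> m < p -> p <= m.*2 -> False) ->
  'C(m.*2, m) <= m.*2 ^ r * 4 ^ (m.*2 %/ 3).
Proof.
move=> m2 /andP[rm mr] nop; set t := m.*2 %/ 3; set M := 'C(_, _).
have M0 : 0 < M by rewrite bin_gt0; lia.
set B := M + m.*2.
have rB : r <= B by apply: leq_trans (leq_trans rm _); rewrite ?leq_addl // -mulnn; nia.
have tB : t <= B by rewrite (leq_trans (leq_div _ _)) ?leq_addl.
(* Factorwise bound: every p <= r is allotted 2m, and every prime p <= t a further factor p. *)
apply: (@leq_trans (\prod_(0 <= p < B.+1) ((if (1 <= p) && (p < r.+1) then m.*2 else 1)
    * (if prime p && (p < t.+1) then p else 1)))); last first.
  rewrite big_split /=; apply: leq_mul; rewrite -big_mkcond /=; last first.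
    by rewrite -(big_nat_widen 0 t.+1 B.+1) // primorial_le.
  rewrite -(big_nat_widen 0 r.+1 B.+1 (fun p => 1 <= p)) //.
  rewrite -(big_nat_widenl 1 0 r.+1 xpredT) //.
  by rewrite prod_nat_const_nat subSS subn0.
rewrite [leqLHS](prod_pfactor_widen M B) ?leq_addr //.
apply: leq_prod => p _.
have [pp|npp] := boolP (prime p); last first.
  have -> : logn p M = 0 by rewrite lognE (negPf npp).
  by rewrite muln1; case: ifP => //; lia.
have pM : p ^ logn p M <= m.*2 by apply: pfactor_bin_central_le; lia.
rewrite prime_gt0 //= ltnS; case: (leqP p r) => [pr|rp].
  apply: leq_trans pM _; rewrite leq_pmulr //; case: ifP => // _; exact: prime_gt0.
have mp2 : m.*2 < p ^ 2 by rewrite (leq_trans mr) // leq_exp2r.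
rewrite mul1n logn_bin_central_lt_square //.
have p0 := prime_gt0 pp.
case: ltnP => [pt|tp].
  rewrite -[leqRHS]expn1 leq_exp2l ?prime_gt1 // leq_subLR.
  rewrite -ltnS ltn_divLR //; have := ltn_ceil m p0; nia.
(* For 2m/3 < p <= m the exponent is 0, since floor(2m / p) = 2 and floor(m / p) >= 1. *)
have [pm|mp] := leqP p m.
  have p3m : m.*2 < 3 * p by move: tp; rewrite -[_.+1]/(t.+1) ltn_divLR // mulnC.
  have -> : m.*2 %/ p = 2.
    by apply/eqP; rewrite eqn_leq -ltnS ltn_divLR // leq_divRL // p3m /=; lia.
  suff : 0 < m %/ p by case: (m %/ p).
  by rewrite divn_gt0.
have [pm2|m2p] := leqP p m.*2; first by case: (nop p).
by rewrite divn_small.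
Qed.

Lemma exists_sqrtn (n : nat) : exists r, r ^ 2 <= n < r.+1 ^ 2.
Proof.
elim: n => [|n [r /andP[rn nr]]]; first by exists 0.
have [h|h] := leqP (r.+1 ^ 2) n.+1; last by exists r; rewrite h leqW.
exists r.+1; rewrite h /=; move: nr; rewrite -!mulnn; nia.
Qed.

Lemma linear_le_expn2 (u : nat) : 5 < u -> 6 * u.+1 + 2 <= 2 ^ u.
Proof.
elim: u => // u IH; rewrite ltnS leq_eqVlt => /orP[/eqP <- //|/IH]; rewrite expnS; lia.
Qed.

Lemma bertrand_large (m : nat) : 2000 <= m ->
  exists p, [/\ prime p, m < p & p <= m.*2].
Proof.
move=> mlarge.
have [|nex] := boolP [exists p : 'I_m.*2.+1, prime p && (m < p)].
  by case/existsP => p /andP[pp mp]; exists p; split=> //; rewrite -ltnS.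
exfalso.
have nop p : prime p -> m < p -> p <= m.*2 -> False.
  move=> pp mp pm; case/existsP: nex.
  by exists (Ordinal (pm : p < m.*2.+1)); rewrite /= pp mp.
have [r rm] := exists_sqrtn m.*2.
have m2 : 2 < m by lia.
have le1 := bin_central_le_of_no_prime m r m2 rm nop.
have m0 : 0 < m by lia.
have le2 := expn4_le_bin_central m m0.
case/andP: rm => rm mr.
set t := m.*2 %/ 3 in le1.
have t3 : 3 * t <= m.*2 by rewrite mulnC leq_divM.
have le3 : 4 ^ m <= m.*2 ^ r.+1 * 4 ^ t.
  apply: leq_trans le2 _; rewrite expnS -mulnA leq_pmul2l //; lia.
(* The threshold 2000 enters here: 63^2 = 3969 < 4000 <= 2m. Then r + 1 >= 2^6, whence u >= 6. *)
have r63 : 63 <= r.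
  by rewrite leqNgt; apply/negP => r63; have : r.+1 ^ 2 <= 63 ^ 2; [rewrite leq_exp2r | lia].
set u := trunc_log 2 r.+1.
have u5 : 5 < u by rewrite /u; apply: trunc_log_max => //; rewrite ltnS.
have ur : 2 ^ u <= r.+1 by apply: trunc_logP.
have ru : r.+1 < 2 ^ u.+1 by apply: trunc_log_ltn.
have lin := linear_le_expn2 u u5.
have le4 : 4 ^ (m - t) < 4 ^ (u.+1 * r.+1).
  have tm : t <= m by lia.
  have : 4 ^ (m - t) <= m.*2 ^ r.+1.
    by rewrite -(leq_pmul2r (_ : 0 < 4 ^ t)) ?expn_gt0 // -expnD subnK.
  move=> /leq_ltn_trans -> //.
  have -> : 4 ^ (u.+1 * r.+1) = ((2 ^ u.+1) ^ 2) ^ r.+1.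
    by rewrite -!expnM -[4]/(2 ^ 2) -expnM mulnCA.
  rewrite ltn_exp2r //.
  by rewrite (leq_trans mr) // leq_exp2r // ltnW.
rewrite ltn_exp2l // in le4.
(* Since 3(m - t) >= m, [le4] gives 2m < 6(u+1)(r+1), while [lin] and [ur] give 6(u+1) <= r - 1; so
   2m < r^2 - 1, against r^2 <= 2m. *)
move: rm le4 t3; rewrite -mulnn; nia.
Qed.

Lemma bertrand (m : nat) : 0 < m -> exists p, [/\ prime p, m < p & p <= m.*2].
Proof.
move=> m0; have [|msmall] := leqP 2000 m; first exact: bertrand_large.
have try (q p : nat) : prime p -> p <= q.*2 ->
    (m < q -> exists p, [/\ prime p, m < p & p <= m.*2]) ->
    m < p -> exists p, [/\ prime p, m < p & p <= m.*2].
  move=> pp pq IH mp; have [/IH//|qm] := ltnP m q.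
  by exists p; split=> //; apply: leq_trans pq _; rewrite leq_double.
have {msmall} : m < 2503 by apply: ltn_trans msmall _; lia.
(* A descending chain of primes, each at most twice the next: the first one above m lies in (m,
   2m]. *)
apply: (try 1259) => //; apply: (try 631) => //; apply: (try 317) => //.
apply: (try 163) => //; apply: (try 83) => //; apply: (try 43) => //.
apply: (try 23) => //; apply: (try 13) => //; apply: (try 7) => //.
apply: (try 5) => //; apply: (try 3) => //; apply: (try 2) => //.
by apply: (try 1) => //; rewrite ltnS leqNgt m0.
Qed.

(** * Sylvester determinants *)

Import Order.TTheory GRing.Theory Num.Theory.
Local Open Scope ring_scope.

(* Unlike [Sylvester_mx], the dimensions are not tied to the sizes of [p] and
   [q], so that the matrix commutes with reduction modulo a prime even when the
   degree of [p] drops. *)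
Definition sylvester (R : nzRingType) (m n : nat) (p q : {poly R}) : 'M[R]_(m + n) :=
  col_mx (\matrix_(i < m) poly_rV ('X^i * p)) (\matrix_(i < n) poly_rV ('X^i * q)).

Lemma resultant_sylvester (R : nzRingType) (p q : {poly R}) :
  resultant p q = \det (sylvester R (size q).-1 (size p).-1 p q).
Proof.
rewrite /resultant /sylvester /Sylvester_mx; congr (\det (col_mx _ _)).
  by apply/matrixP=> i j; rewrite !mxE /= rVpoly_delta.
by apply/matrixP=> i j; rewrite !mxE /= rVpoly_delta.
Qed.

Lemma map_sylvester (R S : nzRingType) (f : {rmorphism R -> S}) (m n : nat)
    (p q : {poly R}) :
  map_mx f (sylvester R m n p q) = sylvester S m n (map_poly f p) (map_poly f q).
Proof.
rewrite /sylvester map_col_mx; congr col_mx; apply/matrixP=> i j;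
  by rewrite !mxE -coef_map rmorphM /= map_polyXn.
Qed.

Lemma det_sylvesterZl (R : comNzRingType) (m n : nat) (c : R) (p q : {poly R}) :
  \det (sylvester R m n (c *: p) q) = c ^+ m * \det (sylvester R m n p q).
Proof.
have -> : sylvester R m n (c *: p) q
    = block_mx c%:M 0 0 1%:M *m sylvester R m n p q.
  rewrite /sylvester mul_block_col mul0mx addr0 mul0mx add0r mul1mx mul_scalar_mx.
  by congr col_mx; apply/matrixP=> i j; rewrite !mxE -scalerAr coefZ.
by rewrite det_mulmx det_ublock det1 mulr1 det_scalar.
Qed.

(** This turns a left kernel vector of a Sylvester matrix into a polynomial relation U p + W q = 0,
    up to truncation. *)
Lemma mul_sylvester_band (R : comNzRingType) (m d : nat) (u : 'rV[R]_m) (p : {poly R}) :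
  u *m (\matrix_(i < m) poly_rV ('X^i * p)) = poly_rV (rVpoly u * p) :> 'rV_d.
Proof.
apply/rowP=> j; rewrite !mxE /rVpoly poly_def mulr_suml coef_sum; apply: eq_bigr => i _.
by rewrite !mxE valK -scalerAl coefZ.
Qed.

(** In a relation U p + W q = 0 from a kernel vector, coprimality gives q | U; as deg U < m = deg q,
    U = 0 and then W = 0. Only q needs its exact degree. *)
Lemma det_sylvester_neq0 (F : fieldType) (m n : nat) (p q : {poly F}) :
  (size p <= n.+1)%N -> size q = m.+1 -> coprimep q p ->
  \det (sylvester F m n p q) != 0.
Proof.
move=> sp sq cqp; apply/negP=> /det0P[v nzv].
rewrite -(hsubmxK v) mul_row_col !mul_sylvester_band -linearD /=.
set U := rVpoly _; set W := rVpoly _.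
have sU : (size U <= m)%N by apply: size_poly.
have sW : (size W <= n)%N by apply: size_poly.
(* The degree bounds ensure that [poly_rV] truncates nothing. *)
move/(congr1 rVpoly); rewrite linear0 poly_rV_K; last first.
  apply: leq_trans (size_polyD _ _) _; rewrite geq_max; apply/andP; split.
    apply: leq_trans (size_polyMleq _ _) _.
    by move: (leq_add sU sp); rewrite addnS; case: (_ + _)%N.
  apply: leq_trans (size_polyMleq _ _) _.
  by rewrite sq addnS /= addnC leq_add2l.
move=> UW.
have U0 : U = 0.
  apply/eqP; apply: contraT => nzU.
  have: q %| U * p.
    by rewrite (_ : U * p = - W * q) ?dvdp_mull // mulNr; apply/eqP; rewrite -addr_eq0 UW.
  rewrite Gauss_dvdpl // => /(dvdp_leq nzU); rewrite sq => /leq_trans/(_ sU).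
  by rewrite ltnn.
have W0 : W = 0.
  move: UW; rewrite U0 mul0r add0r => /eqP; rewrite mulf_eq0.
  have /negPf-> : q != 0 by rewrite -size_poly_eq0 sq.
  by rewrite orbF => /eqP.
case/eqP: nzv; rewrite -(hsubmxK v) -(rVpolyK (lsubmx v)) -(rVpolyK (rsubmx v)).
by rewrite -/U -/W U0 W0 !linear0 row_mx0.
Qed.

(* Multiply on the right by the first [m] columns of the Vandermonde matrix
   followed by the last [n] unit vectors: the result is block triangular. *)
Lemma det_sylvester_roots (F : fieldType) (m n : nat) (p : {poly F}) (z : 'I_m -> F) :
  (size p <= n.+1)%N -> injective z ->
  \det (sylvester F m n p (\prod_(i < m) ('X - (z i)%:P))) = \prod_(i < m) p.[z i].
Proof.
move=> sp injz; set q := \prod_(i < m) _.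
have sq : size q = m.+1 by rewrite size_prod_XsubC /index_enum -enumT size_enum_ord.
have mq : q`_m = 1.
  have := monic_prod_XsubC (index_enum 'I_m) xpredT z.
  by rewrite -/q monicE lead_coefE sq => /eqP.
have qz j : q.[z j] = 0.
  by rewrite /q horner_prod (bigD1 j) //= hornerXsubC subrr mul0r.
pose V := Vandermonde m (\row_j z j).
have nzV : \det V != 0.
  rewrite det_Vandermonde; apply/prodf_neq0 => i _; apply/prodf_neq0 => j ij.
  rewrite !mxE subr_eq0; apply/eqP => /injz eij; by rewrite eij ltnn in ij.
pose W := \matrix_(i < m + n, j < m) z j ^+ i.
pose E : 'M[F]_(m + n, n) := col_mx 0 1%:M.
pose S := sylvester F m n p q.
have uW : usubmx W = V by apply/matrixP=> i j; rewrite !mxE.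
have detWE : \det (row_mx W E) = \det V.
  by rewrite -(vsubmxK W) uW /E -block_mxEh det_lblock det1 mulr1.
have hornerE (r : {poly F}) j : (size r <= m + n)%N ->
    \sum_(k < m + n) r`_k * z j ^+ k = r.[z j].
  by move=> sr; rewrite (horner_coef_wide _ sr).
have sMX (r : {poly F}) (i : nat) : (size r <= (m + n - i))%N -> (i < m + n)%N ->
   (size ('X^i * r)%R <= m + n)%N.
  move=> sr im; apply: leq_trans (size_polyMleq _ _) _.
  by rewrite size_polyXn /= (leq_trans (leq_add (leqnn i) sr)) // subnKC // ltnW.
(* A row of coefficients times the powers of [z j] is an evaluation at [z j], which kills the rows
   coming from q. *)
have SW : S *m W = col_mx (V *m diag_mx (\row_j p.[z j])) 0.
  rewrite mul_col_mx; congr col_mx; apply/matrixP=> i j; rewrite mxE.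
    under eq_bigr do rewrite !mxE.
    rewrite hornerE ?hornerM ?hornerXn ?mul_mx_diag ?mxE //.
    apply: sMX; [| exact: leq_trans (ltn_ord i) (leq_addr _ _)].
    by apply: leq_trans sp _; have := ltn_ord i; lia.
  under eq_bigr do rewrite !mxE.
  rewrite hornerE ?hornerM ?qz ?mulr0 ?mxE //.
  apply: sMX; [| exact: leq_trans (ltn_ord i) (leq_addl _ _)].
  by rewrite sq; have := ltn_ord i; lia.
have SE : S *m E = rsubmx S.
  by rewrite -{1}(hsubmxK S) mul_row_col mulmx0 mulmx1 add0r.
(* This block is lower triangular with diagonal entries q_m = 1. *)
have dT : \det (dsubmx (rsubmx S)) = 1.
  rewrite det_trig.
    apply: big1 => i _; rewrite 2!mxE /S /sylvester col_mxEd !mxE coefXnM /= ltnNge leq_addl /=.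
    by rewrite addnK mq.
  apply/is_trig_mxP => i j ij; rewrite 2!mxE /S /sylvester col_mxEd !mxE coefXnM /=.
  case: ifP => // _; apply: nth_default; rewrite sq; have := ltn_ord j; lia.
have : S *m row_mx W E = block_mx (V *m diag_mx (\row_j p.[z j])) (usubmx (rsubmx S)) 0
    (dsubmx (rsubmx S)).
  by rewrite mul_mx_row SW SE block_mxEh vsubmxK.
move/(congr1 determinant); rewrite det_mulmx detWE det_ublock dT mulr1 det_mulmx det_diag.
rewrite mulrC => /(mulfI nzV) ->; by apply: eq_bigr => i _; rewrite mxE.
Qed.

(** * The discriminant of [Fpoly n] *)

(** The constant term is singled out because [0%:R^-1] is 0. *)
Lemma Fpoly_poly n :
  Fpoly n = \poly_(i < n.+1) (if i == 0%N then 1 else i%:R^-1).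
Proof.
rewrite /Fpoly poly_def big_ord_recl /= scale1r expr0; congr (_ + _).
by rewrite big_add1 big_mkord.
Qed.

Lemma coef_Fpoly n i : (0 < i)%N -> (i <= n)%N -> (Fpoly n)`_i = i%:R^-1.
Proof. by rewrite Fpoly_poly coef_poly ltnS => + -> ; case: i. Qed.

Lemma size_Fpoly n : size (Fpoly n) = n.+1.
Proof.
rewrite Fpoly_poly size_poly_eq //; case: n => [|n] //=.
by rewrite invr_eq0 pnatr_eq0.
Qed.

Lemma deriv_Fpoly n : (Fpoly n)^`() = \sum_(i < n) 'X^i.
Proof.
rewrite /Fpoly derivD derivC add0r raddf_sum big_add1 big_mkord /=.
apply: eq_bigr => i _; rewrite derivZ derivXn -scaler_nat scalerA mulVf ?scale1r //.
by rewrite pnatr_eq0.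
Qed.

Lemma sum_Xn_poly (R : nzRingType) n : \sum_(i < n) 'X^i = \poly_(i < n) 1 :> {poly R}.
Proof. by rewrite poly_def; apply: eq_bigr => i _; rewrite scale1r. Qed.

Lemma size_sum_Xn (R : nzRingType) n : size (\sum_(i < n) 'X^i : {poly R}) = n.
Proof.
by case: n => [|n]; rewrite ?big_ord0 ?size_poly0 // sum_Xn_poly size_poly_eq ?oner_neq0.
Qed.

Lemma resultant_Fpoly n :
  resultant (Fpoly n) (Fpoly n)^`() =
  \det (sylvester rat n.-1 n (Fpoly n) (\sum_(i < n) 'X^i)).
Proof. by rewrite resultant_sylvester deriv_Fpoly size_Fpoly size_sum_Xn. Qed.

Lemma disc_FpolyE n : (0 < n)%N ->
  disc (Fpoly n) =
  (-1) ^+ 'C(n, 2) * n%:R * resultant (Fpoly n) (Fpoly n)^`().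
Proof.
by move=> n0; rewrite /disc lead_coefE size_Fpoly /= coef_Fpoly // invrK.
Qed.

(** * The p-adic valuation of the discriminant *)

(** As n < 2 p^k, the only multiple of p^k in [1, n] is p^k itself, so any other j has p-part at
    most p^(k-1); its p'-part divides that of n!. *)
Lemma dvdn_pfactor_partC_strict (p k n j : nat) : prime p ->
  (n < 2 * p ^ k)%N -> (0 < j <= n)%N -> j != (p ^ k)%N ->
  (p * j %| p ^ k * n`!`_p^')%N.
Proof.
move=> pp nlt /andP[j0 jn] jk.
rewrite -(partnC p j0) mulnA dvdn_mul ?partn_dvd ?fact_gt0 ?dvdn_fact ?j0 //.
rewrite p_part -expnS dvdn_exp2l // ltnNge -pfactor_dvdn //.
apply: contra jk => /dvdnP[q def_j]; have pk0 : (0 < p ^ k)%N by rewrite expn_gt0 prime_gt0.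
move: (leq_ltn_trans jn nlt) j0; rewrite def_j ltn_pmul2r // muln_gt0 pk0 andbT.
by case: q {def_j} => [|[|]] //; rewrite mul1n.
Qed.

Lemma dvdn_pfactor_partC (p k n j : nat) : prime p ->
  (n < 2 * p ^ k)%N -> (0 < j <= n)%N -> (j %| p ^ k * n`!`_p^')%N.
Proof.
move=> pp nlt /andP[j0 jn].
rewrite -(partnC p j0) dvdn_mul ?partn_dvd ?fact_gt0 ?dvdn_fact ?j0 //.
rewrite p_part dvdn_exp2l // -ltnS.
have : (p ^ logn p j < p ^ k.+1)%N.
  apply: (@leq_ltn_trans n); first by apply: leq_trans jn; rewrite dvdn_leq ?pfactor_dvdnn.
  by apply: leq_trans nlt _; rewrite expnS leq_mul2r prime_gt1 // orbT.
by rewrite ltn_exp2l ?prime_gt1.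
Qed.

(* The term of degree [p ^ k] is the only one whose coefficient has p-adic
   valuation as low as [- k], so after clearing denominators the polynomial
   becomes a unit times ['X^(p ^ k)] modulo [p], coprime to the derivative. *)
Lemma resultant_Fpoly_pfactor (n p k : nat) : prime p -> (0 < k)%N ->
    (p ^ k <= n < 2 * p ^ k)%N ->
  exists d : int, ~~ (p%:Z %| d)%Z /\
    (p ^ k * n`!`_p^')%:R ^+ n.-1 * resultant (Fpoly n) (Fpoly n)^`() = d%:~R.
Proof.
move=> pp k0 /andP[kn nk]; set c := (p ^ k * _)%N.
have pk0 : (0 < p ^ k)%N by rewrite expn_gt0 prime_gt0.
have n0 : (0 < n)%N by apply: leq_trans kn.
(* [G] is c F_n over the integers: every division [c %/ i] with 0 < i <= n is exact. *)
pose G : {poly int} := \poly_(i < n.+1) (if i == 0 then c else c %/ i)%N%:Z.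
pose S := sylvester int n.-1 n G (\sum_(i < n) 'X^i).
have mapX (R : nzRingType) (f : {rmorphism int -> R}) :
    map_poly f (\sum_(i < n) 'X^i) = \sum_(i < n) 'X^i.
  by rewrite rmorph_sum /=; apply: eq_bigr => i _; rewrite map_polyXn.
have mapGQ : map_poly (intr : int -> rat) G = c%:R *: Fpoly n.
  apply/polyP => i; rewrite coef_map coefZ /= Fpoly_poly !coef_poly ltnS.
  case: leqP => [ni|]; last by rewrite mulr0.
  case: posnP => [_|i0]; first by rewrite mulr1.
  have ic : (i %| c)%N by rewrite dvdn_pfactor_partC ?i0.
  rewrite -[in RHS](divnK ic) natrM mulfK //.
  by rewrite pnatr_eq0 -lt0n.
exists (\det S); split; last first.
  by rewrite resultant_Fpoly -det_sylvesterZl -mapGQ -(mapX _ intr) -map_sylvester det_map_mx.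
have pF := pchar_Fp pp.
have Fp0 (m : nat) : (m%:R == 0 :> 'F_p) = (p %| m)%N by rewrite -(dvdn_pcharf pF).
suff : (\det S)%:~R != 0 :> 'F_p.
  apply: contra => /dvdzP[e ->]; rewrite rmorphM /= -pmulrn.
  by rewrite (pcharf0 pF) mulr0.
rewrite -det_map_mx map_sylvester mapX /=.
set u := (c %/ p ^ k)%N.
have cu : c = (p ^ k * u)%N by rewrite /u /c mulKn.
have u0 : u%:R != 0 :> 'F_p.
  rewrite Fp0 /u /c mulKn // -prime_coprime //.
  by rewrite -{1}(part_pnat_id (pnat_id pp)) coprime_partC.
have mapGp : map_poly (intr : int -> 'F_p) G = u%:R *: 'X^(p ^ k).
  apply/polyP => i; rewrite coef_map coefZ /= coefXn coef_poly ltnS.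
  case: (eqVneq i (p ^ k)%N) => [->|nik].
    by rewrite kn mulr1 -pmulrn gtn_eqF.
  rewrite mulr0; case: leqP => // ni; rewrite -pmulrn; apply/eqP; rewrite Fp0.
  case: posnP => [i0|i0]; first by rewrite cu dvdn_mulr // dvdn_exp.
  rewrite dvdn_divRL /c; first by apply: dvdn_pfactor_partC_strict; rewrite ?i0.
  by apply: dvdn_pfactor_partC; rewrite ?i0.
(* Modulo p the degree of [G] is p^k, possibly below n; coprimality holds because the derivative
   takes the value 1 at 0. *)
rewrite mapGp; apply: det_sylvester_neq0.
- by rewrite (leq_trans (size_scale_leq _ _)) // size_polyXn ltnS.
- by rewrite size_sum_Xn prednK.
rewrite coprimepZr // coprimep_expr // coprimepX /root horner_sum.
case: n n0 {kn nk c G S mapX mapGQ u cu u0 mapGp} => // n _; rewrite big_ord_recl.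
by rewrite big1 ?addr0 ?hornerC ?oner_neq0 // => i _; rewrite hornerXn expr0n.
Qed.

Lemma disc_Fpoly_nonsquare (n p k : nat) : prime p -> (0 < k)%N ->
    (p ^ k <= n < 2 * p ^ k)%N -> odd (logn p n + k * n.-1) ->
  ~ exists r : rat, disc (Fpoly n) = r ^+ 2.
Proof.
move=> pp k0 pkn; have [d [pd]] := resultant_Fpoly_pfactor n p k pp k0 pkn.
have pk0 : (0 < p ^ k)%N by rewrite expn_gt0 prime_gt0.
have n0 : (0 < n)%N by case/andP: pkn => + _; apply: leq_trans.
set L := (n`!`_p^')%N => resE oddv [r]; rewrite disc_FpolyE // => rE.
have logL : logn p L = 0%N.
  by apply: logn_coprime; rewrite -(part_pnat_id (pnat_id pp)) coprime_partC.
(* With denominators cleared and signs dropped, this becomes an equation in natural numbers whose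
   valuations at p have different parities. *)
have : (p ^ k * L)%:R ^+ n.-1 * (numq r)%:~R ^+ 2
     = (-1) ^+ 'C(n, 2) * n%:R * d%:~R * (denq r)%:~R ^+ 2 :> rat.
  by rewrite numqE exprMn -rE -resE mulrA; congr (_ * _); rewrite mulrCA mulrA.
rewrite -natrX -[(-1)^+_](rmorph_sign (intr : int -> rat)) !pmulrn -!rmorphXn -!rmorphM.
move/intr_inj/(congr1 absz); rewrite !abszM !abszX abszN1 exp1n mul1n !absz_nat.
set A := `|numq r|%N; set B := `|denq r|%N; set D := `|d|%N => ABE.
have pD : ~~ (p %| D)%N by rewrite -(dvdzE p%:Z).
have D0 : (0 < D)%N by case: D pD {ABE} => //; rewrite dvdn0.
have B0 : (0 < B)%N by rewrite absz_gt0 denq_neq0.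
have L0 : (0 < L)%N by apply: part_gt0.
have pkL0 : (0 < p ^ k * L)%N by rewrite muln_gt0 pk0.
have A0 : (0 < A)%N.
  rewrite lt0n; apply/eqP => A0; move: ABE; rewrite A0 !muln0 => /esym/eqP.
  by rewrite !muln_eq0 !gtn_eqF.
move/(congr1 (logn p)): ABE oddv.
rewrite !lognM ?muln_gt0 ?expn_gt0 ?pkL0 ?n0 ?D0 ?A0 ?B0 // !lognX.
rewrite lognM // logL addn0 pfactorK // (logn_coprime (m := D)) ?prime_coprime // addn0.
lia.
Qed.

(** * The resultant over the roots of unity, and its sign *)

Lemma resultant_Fpoly_roots (n : nat) (z : algC) : (0 < n)%N -> n.-primitive_root z ->
  ratr (resultant (Fpoly n) (Fpoly n)^`()) =
  \prod_(i < n.-1) (map_poly ratr (Fpoly n)).[z ^+ i.+1].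
Proof.
case: n => // n _ zprim.
rewrite resultant_Fpoly /= -det_map_mx map_sylvester.
have -> : map_poly ratr (\sum_(i < n.+1) 'X^i) =
    \prod_(i < n) ('X - (z ^+ i.+1)%:P) :> {poly algC}.
  (* After multiplication by X - 1, both sides equal X^(n+1) - 1 for the shifted [n]. *)
  have nz : 'X - 1 != 0 :> {poly algC} by rewrite polyXsubC_eq0.
  apply: (mulfI nz); rewrite rmorph_sum /=.
  under eq_bigr do rewrite map_polyXn.
  by rewrite -subrX1 -(factor_Xn_sub_1 zprim) big_mkord big_ord_recl expr0.
rewrite det_sylvester_roots //; first by rewrite size_map_poly size_Fpoly.
move=> i j /eqP; rewrite (eq_prim_root_expr zprim) !modn_small ?ltnS //.
by move=> /eqP[] /val_inj.
Qed.

Lemma resultant_Fpoly_ge0 (n : nat) : odd n ->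
  0 <= resultant (Fpoly n) (Fpoly n)^`().
Proof.
move=> on; have n0 : (0 < n)%N by case: n on.
have [z zprim] := C_prim_root_exists n0.
rewrite -(ler0q algC) (resultant_Fpoly_roots n z) //.
set P := map_poly _ _.
have norm_z : `|z| = 1.
  apply/eqP; rewrite -(@pexpr_eq1 _ _ n) //.
  by rewrite -normrX prim_expr_order // normr1.
have conj_z i j : (i + j)%N = n -> z ^+ i = (z ^+ j)^*.
  move=> ijn; have : z ^+ j != 0 by rewrite expf_neq0 // -normr_eq0 norm_z oner_neq0.
  move/mulIf; apply; rewrite -exprD ijn prim_expr_order // [RHS]mulrC -normCK.
  by rewrite normrX norm_z !expr1n.
have conjP x : P.[x^*] = P.[x]^*.
  rewrite -horner_map; congr (_.[_]); apply/polyP => i; rewrite !coef_map /=.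
  by rewrite fmorph_rat.
have [h def_n] : exists h, n = (h + h).+1.
  by exists n./2; rewrite -[LHS]odd_double_half on addnn.
rewrite -(big_mkord xpredT (fun i => P.[z ^+ i.+1])) {1}def_n.
(* Reversing the second half pairs z^(i+1) with its conjugate z^(n-i-1). *)
rewrite big_mkord big_split_ord /= [X in _ * X](reindex_inj rev_ord_inj) /=.
rewrite [X in _ * X](eq_bigr (fun i : 'I_h => P.[z ^+ i.+1]^*)); last first.
  move=> i _; rewrite -conjP -(conj_z (h + (h - i.+1)).+1) //; have := ltn_ord i; lia.
by rewrite -rmorph_prod mul_conjC_ge0.
Qed.

(** Bertrand's postulate only offers p = 2 here, where the valuation is even; instead, F_2(-1) = 1/2
    gives the value. *)
Lemma disc_Fpoly2 : disc (Fpoly 2) = -1.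
Proof.
have zprim : 2.-primitive_root (-1 : algC).
  apply/andP; split=> //; apply/forallP=> i; apply/eqP; rewrite unity_rootE.
  case: i => [[|[|i]]] //= _; rewrite ?sqrrN ?expr1n ?eqxx //.
  apply/negbTE; rewrite expr1 -subr_eq0 -opprD oppr_eq0.
  by rewrite (pnatr_eq0 _ 2).
rewrite disc_FpolyE //; apply: (fmorph_inj (ratr : rat -> algC)).
rewrite rmorphM /= (resultant_Fpoly_roots 2 (-1)) //.
rewrite big_ord1 /= expr1 -(rmorphN1 (ratr : {rmorphism rat -> algC})) horner_map -rmorphM /=.
by congr ratr; rewrite /Fpoly big_nat_recl // big_nat1 !hornerE.
Qed.

(** The prime 2 always qualifies: 2^k <= n < 2^(k+1) for k the integer part of log_2 n. *)
Lemma resultant_Fpoly_neq0 (n : nat) : (1 < n)%N ->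
  resultant (Fpoly n) (Fpoly n)^`() != 0.
Proof.
move=> n1; have n0 := ltnW n1; set k := trunc_log 2 n.
have k0 : (0 < k)%N by rewrite trunc_log_gt0.
have kn : (2 ^ k <= n < 2 * 2 ^ k)%N by rewrite trunc_logP // -expnS trunc_log_ltn.
have [d [d2 dE]] := resultant_Fpoly_pfactor n 2 k isT k0 kn.
apply: contra d2 => /eqP res0; move/esym/eqP: dE.
by rewrite res0 mulr0 intr_eq0 => /eqP ->; rewrite dvdz0.
Qed.

(** * The residue classes of n modulo 4 *)

Lemma disc_Fpoly_even_nonsquare (n : nat) : (2 < n)%N -> ~~ odd n ->
  ~ exists r : rat, disc (Fpoly n) = r ^+ 2.
Proof.
move=> n2 en; have [|p [pp mp pm]] := bertrand n./2; first by lia.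
apply: (disc_Fpoly_nonsquare n p 1) => //; first by rewrite expn1; lia.
rewrite logn_coprime ?mul1n ?add0n; first by lia.
(* If p divided n < 2p, then n = p would be an even prime greater than 2. *)
rewrite prime_coprime //; apply/negP => /dvdnP[q def_n].
have q1 : q = 1%N by move: pp => /prime_gt0; nia.
have /even_prime[] := pp; lia.
Qed.

Lemma disc_Fpoly_lt0 (n : nat) : n = 3 %[mod 4] -> disc (Fpoly n) < 0.
Proof.
move=> n3; rewrite disc_FpolyE; last by lia.
have n1 : (1 < n)%N by lia.
have /eqP := resultant_Fpoly_neq0 n n1; have : odd n by lia.
move=> /resultant_Fpoly_ge0; rewrite le0r => /orP[/eqP //|res_gt0 _].
have bin_odd : odd 'C(n, 2) by rewrite bin2odd ?oddM; lia.
rewrite -signr_odd bin_odd expr1 mulN1r mulNr oppr_lt0 mulr_gt0 // ltr0n; lia.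
Qed.

Theorem theorem1p1 (n : nat) (hn : (1 <= n)%N)
    (h : [\/ n = 0 %[mod 4], n = 2 %[mod 4], n = 3 %[mod 4]
           | n = 1 %[mod 4] /\
             exists p e : nat, [/\ prime p, odd e & n = (p ^ e)%N]]) :
  ~ exists r : rat, disc (Fpoly n) = r ^+ 2.
Proof.
have neg : disc (Fpoly n) < 0 -> ~ exists r : rat, disc (Fpoly n) = r ^+ 2.
  by move=> disc_lt0 [r rE]; move: disc_lt0; rewrite rE ltNge sqr_ge0.
have even : ~~ odd n -> ~ exists r : rat, disc (Fpoly n) = r ^+ 2.
  move=> en; have [n2|n2] := ltnP 2 n; first exact: disc_Fpoly_even_nonsquare.
  by apply: neg; rewrite (_ : n = 2%N) ?disc_Fpoly2 //; lia.
case: h => [n0|n2|n3|[n1 [p [e [pp oe def_n]]]]].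
- apply: even; lia.
- apply: even; lia.
- exact/neg/disc_Fpoly_lt0.
have e0 : (0 < e)%N by case: e oe {def_n}.
apply: (disc_Fpoly_nonsquare n p e) => //.
  by rewrite -def_n leqnn ltn_Pmull.
have -> : logn p n = e by rewrite def_n pfactorK.
(* As n - 1 is even, e + e(n - 1) has the parity of e. *)
by rewrite oddD oddM oe /=; lia.
Qed.
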